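(* Let $(\mathcal{L},\circ_\lambda,\ast_\lambda)$ be a pre-Lie commutative conformal superalgebra. Suppose that $(a\circ_\lambda b)\ast_{\lambda+\mu}c=a\circ_\lambda(b\ast_\mu c)$ for all $a,b,c\in\mathcal{L}$. Then $(\mathcal{L},\circ_\lambda,[\cdot_\lambda\cdot])$ is a transposed Poisson conformal superalgebra (TPCSA), where $[a_\lambda b]=a\ast_\lambda b-(-1)^{|a||b|}(b\ast_{-\partial-\lambda}a)$ for all $a,b\in\mathcal{L}$. In particular, the conclusion holds when $(\mathcal{L},\circ_\lambda,\ast_\lambda)$ is a differential Novikov-Poisson conformal superalgebra.
   Context: All vector spaces and linear maps are over $\mathbb{C}$. A $\mathbb{Z}_2$-graded $\mathbb{C}[\partial]$-module is a $\mathbb{C}[\partial]$-module $A=A_{\bar0}\oplus A_{\bar1}$ with $\partial A_i\subseteq A_i$; $|a|$ denotes the parity of a homogeneous element $a$. Whenever $|a|$ occurs, $a$ is assumed homogeneous, and the formula is extended by linearity. $A[\lambda]$ denotes polynomials in $\lambda$ with coefficients in $A$. A conformal superalgebra $(A,\circ_\lambda)$ is a $\mathbb{Z}_2$-graded $\mathbb{C}[\partial]$-module $A$ with a $\mathbb{C}$-bilinear map $A\otimes A\to A[\lambda]$, $a\otimes b\mapsto a\circ_\lambda b$, with $A_i\circ_\lambda A_j\subseteq A_{i+j}[\lambda]$, satisfying sesquilinearity: $(\partial a)\circ_\lambda b=-\lambda\, a\circ_\lambda b$, $a\circ_\lambda(\partial b)=(\partial+\lambda)(a\circ_\lambda b)$.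 Substitution convention: if $a\circ_\lambda b=\sum_n\lambda^n c_n$, then $a\circ_{-\partial-\lambda}b=\sum_n(-\partial-\lambda)^nc_n$ with $\partial$ acting on the coefficients $c_n$, and similarly for other products and brackets; in nested expressions, a $\partial$ in a subscript acts on the result of the product of which it is the subscript. It is commutative if $a\circ_\lambda b=(-1)^{|a||b|}b\circ_{-\partial-\lambda}a$, and associative if $a\circ_\lambda(b\circ_\mu c)=(a\circ_\lambda b)\circ_{\lambda+\mu}c$, for all $a,b,c$. A left-symmetric conformal superalgebra $(A,\ast_\lambda)$ is a conformal superalgebra with $(a\ast_\lambda b)\ast_{\lambda+\mu}c-a\ast_\lambda(b\ast_\mu c)=(-1)^{|a||b|}\big((b\ast_\mu a)\ast_{\lambda+\mu}c-b\ast_\mu(a\ast_\lambda c)\big)$. A Novikov conformal superalgebra is a left-symmetric conformal superalgebra with $(a\ast_\lambda b)\ast_{\lambda+\mu}c=(-1)^{|b||c|}(a\ast_\lambda c)\ast_{-\mu-\partial}b$. Consider, for two products $\circ_\lambda,\ast_\lambda$ on the same module, the identities (A) $(a\circ_\lambda b)\ast_{\lambda+\mu}c=a\circ_\lambda(b\ast_\mu c)$; (B) $(a\ast_\lambda b)\circ_{\lambda+\mu}c-a\ast_\lambda(b\circ_\mu c)=(-1)^{|a||b|}\big((b\ast_\mu a)\circ_{\lambda+\mu}c-b\ast_\mu(a\circ_\lambda c)\big)$; (C) $a\ast_\lambda(b\circ_\mu c)=(a\ast_\lambda b)\circ_{\lambda+\mu}c+(-1)^{|a||b|}b\circ_\mu(a\ast_\lambda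 c)$. A pre-Lie commutative conformal superalgebra is a triple with $\circ_\lambda$ commutative associative, $\ast_\lambda$ left-symmetric, and (C) for all $a,b,c$. A differential Novikov-Poisson conformal superalgebra is a triple with $\circ_\lambda$ commutative associative, $\ast_\lambda$ Novikov, and (A), (B), (C) for all $a,b,c$. A Lie conformal superalgebra $(A,[\cdot_\lambda\cdot])$ is a $\mathbb{Z}_2$-graded $\mathbb{C}[\partial]$-module with a $\mathbb{C}$-bilinear map $a\otimes b\mapsto[a_\lambda b]\in A[\lambda]$, $[{A_i}_\lambda A_j]\subseteq A_{i+j}[\lambda]$, such that $[(\partial a)_\lambda b]=-\lambda[a_\lambda b]$, $[a_\lambda(\partial b)]=(\partial+\lambda)[a_\lambda b]$, $[a_\lambda b]=-(-1)^{|a||b|}[b_{-\lambda-\partial}a]$, and $[a_\lambda[b_\mu c]]=[[a_\lambda b]_{\lambda+\mu}c]+(-1)^{|a||b|}[b_\mu[a_\lambda c]]$. A transposed Poisson conformal superalgebra (TPCSA) is a $\mathbb{Z}_2$-graded $\mathbb{C}[\partial]$-module $\mathcal{L}$ with $\circ_\lambda$ and $[\cdot_\lambda\cdot]$ such that $(\mathcal{L},\circ_\lambda)$ is a commutative associative conformal superalgebra, $(\mathcal{L},[\cdot_\lambda\cdot])$ is a Lie conformal superalgebra, and $2(a\circ_\lambda[b_\mu c])=[(a\circ_\lambda b)_{\lambda+\mu}c]+(-1)^{|a||b|}[b_\mu(a\circ_\lambda c)]$ for all $a,b,c\in\mathcal{L}$. *)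

(* Defs.v *)
From HB Require Import structures.
From mathcomp Require Import all_boot all_order all_algebra.
From mathcomp Require Import finmap.
From mathcomp Require Import reals complex.
From mathcomp Require Import monalg.

Set Implicit Arguments.
Unset Strict Implicit.
Unset Printing Implicit Defensive.

Import GRing.Theory.
Local Open Scope ring_scope.

(* Polynomials with coefficients in a module: [coefpoly A nat] is A[λ] and
   [coefpoly A (nat * nat)] is A[λ, μ], where the exponent [(m, n)] stands for
   λ^m μ^n.  The alias of [{malg A[K]}] is needed because the scalars act on
   the coefficients here, whereas the module structure of [{malg R[K]}] has R
   itself as ring of scalars. *)
Definition coefpoly (S : nzRingType) (A : lmodType S) (K : choiceType) : Type :=
  {malg A[K]}.

HB.instance Definition _ (S : nzRingType) (A : lmodType S)
  (K : choiceType) :=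
  GRing.Zmodule.on (@coefpoly S A K).

Section CoefpolyLmodule.
Context (S : nzRingType) (A : lmodType S) (K : choiceType).
Implicit Types (s : S) (p : @coefpoly S A K).

Definition coefpoly_scale s p : @coefpoly S A K :=
  \sum_(k <- msupp p) << s *: p@_k *g k >>.

Lemma coefpoly_scaleE s p k : (coefpoly_scale s p)@_k = s *: p@_k.
Proof.
rewrite [in RHS](monalgE p) /coefpoly_scale !raddf_sum.
by apply: eq_bigr => i _; rewrite /= !mcoeffU scalerMnr.
Qed.

Fact coefpoly_scaleA s t p :
  coefpoly_scale s (coefpoly_scale t p) = coefpoly_scale (s * t) p.
Proof. by apply/malgP => k; rewrite !coefpoly_scaleE scalerA. Qed.

Fact coefpoly_scale1 : left_id 1 coefpoly_scale.
Proof. by move=> p; apply/malgP => k; rewrite coefpoly_scaleE scale1r. Qed.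

Fact coefpoly_scaleDr : right_distributive coefpoly_scale +%R.
Proof.
move=> s p q; apply/malgP => k.
by rewrite coefpoly_scaleE !mcoeffD !coefpoly_scaleE scalerDr.
Qed.

Fact coefpoly_scaleDl p : {morph coefpoly_scale^~ p : s t / s + t}.
Proof.
move=> s t; apply/malgP => k.
by rewrite mcoeffD !coefpoly_scaleE scalerDl.
Qed.

HB.instance Definition _ := GRing.Zmodule_isLmodule.Build S (@coefpoly S A K)
  coefpoly_scaleA coefpoly_scale1 coefpoly_scaleDr coefpoly_scaleDl.

Lemma coefpolyZ s p k : (s *: p)@_k = s *: p@_k.
Proof. exact: coefpoly_scaleE. Qed.

Definition mulvar (f : K -> K) p : @coefpoly S A K :=
  \sum_(k <- msupp p) << p@_k *g f k >>.

End CoefpolyLmodule.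

Notation "A '[λ]'" := (coefpoly A nat)
  (at level 2, format "A [λ]") : type_scope.
Notation "A '[λ,μ]'" := (coefpoly A (nat * nat)%type)
  (at level 2, format "A [λ,μ]") : type_scope.

Section Substitution.
Context (R : realType) (A : lmodType {poly R[i]}).

(* A [C[∂]]-module is a module over the polynomial ring, ∂ being the action of
   the indeterminate; it acts on the coefficients in A[λ] and A[λ,μ]. *)
Definition der (M : lmodType {poly R[i]}) (m : M) : M := 'X *: m.

Definition mul_lam1 : A[λ] -> A[λ] := mulvar S.
Definition mul_lam : A[λ,μ] -> A[λ,μ] := mulvar (fun k => (k.1.+1, k.2)).
Definition mul_mu : A[λ,μ] -> A[λ,μ] := mulvar (fun k => (k.1, k.2.+1)).

Definition const1 (a : A) : A[λ] := << a *g 0%N >>.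
Definition const2 (a : A) : A[λ,μ] := << a *g (0%N, 0%N) >>.

(* [psubst T f p] is Σ_n T^n (f c_n) when p = Σ_n λ^n c_n. *)
Definition psubst (M : zmodType) (T : M -> M) (f : A -> M) (p : A[λ]) : M :=
  \sum_(n <- msupp p) iter n T (f p@_n).

(* Operators to substitute for the variable: λ+μ, -μ-∂ and -∂-λ. *)
Definition sub_lamDmu (p : A[λ,μ]) : A[λ,μ] := mul_lam p + mul_mu p.
Definition sub_NmuBder (p : A[λ,μ]) : A[λ,μ] := - mul_mu p - der p.
Definition sub_NderBlam (p : A[λ]) : A[λ] := - der p - mul_lam1 p.

(* a f_{-∂-λ} b *)
Definition opprod (f : A -> A -> A[λ]) (a b : A) : A[λ] :=
  psubst sub_NderBlam const1 (f a b).

(* (a f_T b) g_U c *)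
Definition nestl (f : A -> A -> A[λ]) (T : A[λ,μ] -> A[λ,μ]) (a b : A)
    (g : A -> A -> A[λ]) (U : A[λ,μ] -> A[λ,μ]) (c : A) : A[λ,μ] :=
  psubst T (fun x => psubst U const2 (g x c)) (f a b).

(* a f_T (b g_U c) *)
Definition nestr (f : A -> A -> A[λ]) (T : A[λ,μ] -> A[λ,μ]) (a : A)
    (g : A -> A -> A[λ]) (U : A[λ,μ] -> A[λ,μ]) (b c : A) : A[λ,μ] :=
  psubst U (fun x => psubst T const2 (f a x)) (g b c).

End Substitution.

Arguments mul_lam {R A}.
Arguments mul_mu {R A}.
Arguments sub_lamDmu {R A}.
Arguments sub_NmuBder {R A}.

(* The components of an element are determined by the last two axioms. *)
Record z2grading (R : realType) (A : lmodType {poly R[i]}) := Z2Grading {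
  homog : 'Z_2 -> submodClosed A;
  component : 'Z_2 -> A -> A;
  component_homog : forall i a, component i a \in homog i;
  component_sum : forall a, a = component 0 a + component 1 a;
  homog_disjoint : forall a, a \in homog 0 -> a \in homog 1 -> a = 0
}.

Definition sgn (R : realType) (M : lmodType {poly R[i]}) (i j : 'Z_2) (m : M) :
  M := (-1) ^+ (i * j)%N *: m.

Section Structures.
Context (R : realType) (A : lmodType {poly R[i]}) (G : z2grading A).
Implicit Types (i j k : 'Z_2) (a b c : A) (circ star br : A -> A -> A[λ]).

Local Notation lam := mul_lam.
Local Notation mu := mul_mu.
Local Notation lamDmu := sub_lamDmu.
Local Notation NmuBder := sub_NmuBder.

Record conformal_superalgebra (f : A -> A -> A[λ]) : Prop := {
  conf_linearl : forall (x : R[i]) a a' b,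
    f (x%:P *: a + a') b = x%:P *: f a b + f a' b;
  conf_linearr : forall (x : R[i]) a b b',
    f a (x%:P *: b + b') = x%:P *: f a b + f a b';
  conf_graded : forall i j a b, a \in homog G i -> b \in homog G j ->
    forall n, (f a b)@_n \in homog G (i + j);
  conf_sesquil : forall a b, f (der a) b = - mul_lam1 (f a b);
  conf_sesquir : forall a b, f a (der b) = der (f a b) + mul_lam1 (f a b)
}.

Definition conf_commutative circ : Prop :=
  forall i j a b, a \in homog G i -> b \in homog G j ->
  circ a b = sgn i j (opprod circ b a).

Definition conf_associative circ : Prop :=
  forall a b c,
  nestr circ lam a circ mu b c = nestl circ lam a b circ lamDmu c.

Definition comm_assoc_conformal_superalgebra circ : Prop :=
  [/\ conformal_superalgebra circ, conf_commutative circ &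
      conf_associative circ].

Definition left_symmetric_conformal_superalgebra star : Prop :=
  conformal_superalgebra star /\
  forall i j a b c, a \in homog G i -> b \in homog G j ->
  nestl star lam a b star lamDmu c - nestr star lam a star mu b c =
  sgn i j (nestl star mu b a star lamDmu c - nestr star mu b star lam a c).

Definition novikov_conformal_superalgebra star : Prop :=
  left_symmetric_conformal_superalgebra star /\
  forall j k a b c, b \in homog G j -> c \in homog G k ->
  nestl star lam a b star lamDmu c = sgn j k (nestl star lam a c star NmuBder b).

Definition compatA circ star : Prop :=
  forall a b c,
  nestl circ lam a b star lamDmu c = nestr circ lam a star mu b c.

Definition compatB circ star : Prop :=
  forall i j a b c, a \in homog G i -> b \in homog G j ->
  nestl star lam a b circ lamDmu c - nestr star lam a circ mu b c =
  sgn i j (nestl star mu b a circ lamDmu c - nestr star mu b circ lam a c).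

Definition compatC circ star : Prop :=
  forall i j a b c, a \in homog G i -> b \in homog G j ->
  nestr star lam a circ mu b c =
  nestl star lam a b circ lamDmu c + sgn i j (nestr circ mu b star lam a c).

Definition prelie_commutative_conformal_superalgebra circ star : Prop :=
  [/\ comm_assoc_conformal_superalgebra circ,
      left_symmetric_conformal_superalgebra star & compatC circ star].

Definition diff_novikov_poisson_conformal_superalgebra circ star : Prop :=
  [/\ comm_assoc_conformal_superalgebra circ,
      novikov_conformal_superalgebra star,
      compatA circ star, compatB circ star & compatC circ star].

Record lie_conformal_superalgebra br : Prop := {
  lie_conformal : conformal_superalgebra br;
  lie_skew : forall i j a b, a \in homog G i -> b \in homog G j ->
    br a b = - sgn i j (opprod br b a);
  lie_jacobi : forall i j a b c, a \in homog G i -> b \in homog G j ->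
    nestr br lam a br mu b c =
    nestl br lam a b br lamDmu c + sgn i j (nestr br mu b br lam a c)
}.

Definition transposed_poisson_conformal_superalgebra circ br : Prop :=
  [/\ comm_assoc_conformal_superalgebra circ, lie_conformal_superalgebra br &
  forall i j a b c, a \in homog G i -> b \in homog G j ->
  nestr circ lam a br mu b c *+ 2 =
  nestl circ lam a b br lamDmu c + sgn i j (nestr br mu b circ lam a c)].

(* Bilinear extension of a ∗_λ b - (-1)^{|a||b|} b ∗_{-∂-λ} a from homogeneous
   elements. *)
Definition commutator star a b : A[λ] :=
  \sum_(i : 'Z_2) \sum_(j : 'Z_2)
    (star (component G i a) (component G j b) -
     sgn i j (opprod star (component G j b) (component G i a))).

Lemma component_id i a : a \in homog G i -> component G i a = a.
Proof.
have dec := component_sum G a.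
have h0 : component G 0 a \in homog G 0 := component_homog G 0 a.
have h1 : component G 1 a \in homog G 1 := component_homog G 1 a.
have [-> | ->] : i = 0 \/ i = 1.
- by case: i => -[|[|//]] ?; [left | right]; apply: val_inj.
- move=> ha; have e : component G 1 a = 0.
    apply: (homog_disjoint _ h1).
    have -> : component G 1 a = a - component G 0 a.
      by rewrite [X in X - _]dec addrC addKr.
    by rewrite -scaleN1r rpredD ?rpredZ.
  by rewrite [RHS]dec e addr0.
- move=> ha; have e : component G 0 a = 0.
    apply: (homog_disjoint h0).
    have -> : component G 0 a = a - component G 1 a.
      by rewrite [X in X - _]dec addrK.
    by rewrite -scaleN1r rpredD ?rpredZ.
  by rewrite [RHS]dec e add0r.
Qed.

Lemma component_neq i j a : a \in homog G i -> j != i -> component G j a = 0.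
Proof.
move=> ha; have dec := component_sum G a; have e := component_id ha.
have c01 k : k = 0 \/ k = 1 :> 'Z_2.
  by case: k => -[|[|//]] ?; [left | right]; apply: val_inj.
case: (c01 i) (c01 j) e dec => -> [->|->] //= {1}<- /eqP; rewrite -subr_eq0.
  by rewrite opprD addNKr oppr_eq0 => /eqP.
by rewrite opprD addrCA subrr addr0 oppr_eq0 => /eqP.
Qed.

Lemma commutatorE star i j a b : conformal_superalgebra star ->
  a \in homog G i -> b \in homog G j ->
  commutator star a b = star a b - sgn i j (opprod star b a).
Proof.
move=> [linl linr _ _ _] ha hb.
have s0l x : star 0 x = 0.
  have := linl 0 0 0 x; rewrite !scale0r !add0r => //.
  by have := linl (-1) x x x; rewrite !polyCN !scaleN1r !addNr.
have s0r x : star x 0 = 0.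
  by have := linr (-1) x x x; rewrite !polyCN !scaleN1r !addNr.
have op0l x : opprod star 0 x = 0 by rewrite /opprod s0l /psubst msupp0 big_nil.
have op0r x : opprod star x 0 = 0 by rewrite /opprod s0r /psubst msupp0 big_nil.
have sgn0 k l : sgn k l (0 : A[λ]) = 0 by rewrite /sgn scaler0.
have neqa k : k != i -> component G k a = 0 by exact: component_neq ha.
have neqb l : l != j -> component G l b = 0 by exact: component_neq hb.
have sumE k (F : 'Z_2 -> A[λ]) :
    (forall l, l != k -> F l = 0) -> \sum_l F l = F k.
  by move=> F0; rewrite (bigD1 k) //= big1 ?addr0.
rewrite /commutator (sumE i); last first.
  by move=> k /neqa ->; apply: big1 => l _; rewrite s0l op0r sgn0 subr0.
rewrite (sumE j); last by move=> l /neqb ->; rewrite s0r op0l sgn0 subr0.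
by rewrite (component_id ha) (component_id hb).
Qed.

End Structures.

(* Main.v *)
(* In an expression (a_x b)_{x+y} c or a_x (b_y c), replacing a product by its
   opposite permutes the operators x, y and z = -∂-x-y.  With the three
   commuting operators λ, μ, ν = -∂-λ-μ the four terms of the expanded
   brackets are thus ordinary nested products, and identities assumed for λ, μ
   hold for any two of λ, μ, ν by substitution.  The Jacobi identity is
   the alternating sum of left-symmetry at (λ, μ), (λ, ν) and (μ, ν), as in the
   classical pre-Lie case.  In the transposed Leibniz rule, (A) and (C) leave
   the two terms (c ∗_ν a) ∘_{λ+ν} b and (b ∗_μ a) ∘_{λ+μ} c, which
   commutativity and (A) both turn into (c ∘_ν b) ∗_{μ+ν} a. *)
From HB Require Import structures.
From mathcomp Require Import all_boot all_order all_algebra.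
From mathcomp Require Import finmap.
From mathcomp Require Import reals complex.
From mathcomp Require Import monalg.
Require Import Defs.

Set Implicit Arguments.
Unset Strict Implicit.
Unset Printing Implicit Defensive.
Import GRing.Theory.
Local Open Scope ring_scope.

(** [psubst T f] is additive only under hypotheses on [T] and [f], so no instance can be inferred
    for it; its additive structure is packed on demand. *)
Definition additive_of (V W : zmodType) (f : V -> W) (addf : zmod_morphism f) :
  {additive V -> W} :=
  HB.pack f (GRing.isZmodMorphism.Build V W f addf).

(** * Polynomials with coefficients in a module *)

Section MalgSum.
Context (K : choiceType) (V W : zmodType) (F : K -> V -> W).
Hypothesis addF : forall k, zmod_morphism (F k).

(** Common shape of [mulvar], [psubst] and the specialization [spec2], whose additivity is thus
    proved only once. *)
Definition malg_sum (p : {malg V[K]}) : W := \sum_(k <- msupp p) F k p@_k.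

Let F0 k : F k 0 = 0.
Proof. by rewrite -(subr0 0) addF subrr. Qed.

(** Since [F k 0 = 0], the summation set may be enlarged, so that polynomials with different
    supports are summed over a common one. *)
Lemma malg_sumEw (d : {fset K}) (p : {malg V[K]}) :
  (msupp p `<=` d)%fset -> malg_sum p = \sum_(k <- d) F k p@_k.
Proof.
move=> sub; apply: big_fset_incl => // k _ knp.
by rewrite mcoeff_outdom.
Qed.

Lemma malg_sum_is_additive : zmod_morphism malg_sum.
Proof.
move=> p q; pose d := (msupp p `|` msupp q)%fset.
rewrite (@malg_sumEw d (p - q)); last exact: msuppB_le.
rewrite (@malg_sumEw d p) ?fsubsetUl // (@malg_sumEw d q) ?fsubsetUr //.
by rewrite -sumrB; apply: eq_bigr => k _; rewrite mcoeffB addF.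
Qed.

Lemma malg_sumU (x : V) k : malg_sum << x *g k >> = F k x.
Proof.
by rewrite (malg_sumEw msuppU_le) big_seq_fset1 mcoeffUU.
Qed.

End MalgSum.

(** A module may have torsion, so scaling can shrink the support; both sums are taken over the
    support of [p]. *)
Lemma malg_sumZ (S : nzRingType) (K : choiceType) (V W : lmodType S)
    (F : K -> V -> W) (s : S) (p : coefpoly V K) :
  (forall k, zmod_morphism (F k)) -> (forall k x, F k (s *: x) = s *: F k x) ->
  malg_sum F (s *: p) = s *: malg_sum F p.
Proof.
move=> addF scalF; rewrite (@malg_sumEw _ _ _ _ addF (msupp p)).
  by rewrite scaler_sumr; apply: eq_bigr => k _; rewrite coefpolyZ.
apply/fsubsetP => k; apply: contraLR; rewrite -!mcoeff_eq0 coefpolyZ => /eqP ->.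
by rewrite scaler0.
Qed.

Lemma malg_sum_is_linear (S : nzRingType) (K : choiceType) (V W : lmodType S)
    (F : K -> V -> W) :
  (forall k, linear (F k)) -> linear (malg_sum F : coefpoly V K -> W).
Proof.
move=> linF.
have addF k : zmod_morphism (F k).
  by move=> x y; rewrite -[x - y]addrC -scaleN1r linF scaleN1r addrC.
have scalF k s x : F k (s *: x) = s *: F k x.
  have F0 : F k 0 = 0 by rewrite -(subr0 0) addF subrr.
  by rewrite -[s *: x]addr0 linF F0 addr0.
(* [zmod_morphism] speaks of differences, so the sum is written as [s *: p - (- q)], and then [- q]
   as [0 - q]. *)
move=> s p q; rewrite -[q in LHS]opprK malg_sum_is_additive // malg_sumZ //.
rewrite -[- q]add0r malg_sum_is_additive //.
by rewrite -(subrr 0) malg_sum_is_additive // subrr sub0r opprK.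
Qed.

Lemma iter_is_additive (V : zmodType) n (T : {additive V -> V}) :
  zmod_morphism (iter n T).
Proof.
by elim: n => // n IHn x y; rewrite [LHS]iterS IHn raddfB.
Qed.

Lemma iter_is_linear (S : nzRingType) (V : lmodType S) n
    (T : {linear V -> V}) : linear (iter n T).
Proof.
by elim: n => // n IHn s x y; rewrite [LHS]iterS IHn linearP.
Qed.

Lemma iter_comm (V W : Type) (h : V -> W) (T : V -> V) (T' : W -> W) n x :
  (forall v, h (T v) = T' (h v)) -> h (iter n T x) = iter n T' (h x).
Proof. by move=> hT; elim: n => //= n IHn; rewrite hT IHn. Qed.

Lemma monalgU_is_linear (S : nzRingType) (V : lmodType S) (K : choiceType)
    (k : K) :
  linear (fun x : V => << x *g k >> : coefpoly V K).
Proof.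
move=> s x y; rewrite monalgUD; congr (_ + _); apply/malgP => l.
by rewrite coefpolyZ !mcoeffU scalerMnr.
Qed.

Arguments monalgU_is_linear {S} V {K} k.

(** * Linearity of ∂ and of multiplication by the variables *)

Section Operators.
Context (R : realType) (A : lmodType {poly R[i]}).

Lemma der_is_linear (M : lmodType {poly R[i]}) : linear (@der R M).
Proof. by move=> s x y; rewrite /der scalerDr !scalerA mulrC. Qed.

HB.instance Definition _ (M : lmodType {poly R[i]}) :=
  GRing.isLinear.Build _ M M _ (@der R M) (@der_is_linear M).

Lemma mulvar_is_linear (K : choiceType) (h : K -> K) :
  linear (@mulvar _ A K h).
Proof.
exact: (malg_sum_is_linear (fun k => monalgU_is_linear A (h k))).
Qed.

HB.instance Definition _ (K : choiceType) (h : K -> K) :=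
  GRing.isLinear.Build _ _ _ _ (@mulvar _ A K h) (mulvar_is_linear h).
HB.instance Definition _ := GRing.Linear.copy (@mul_lam1 R A) (mulvar S).
HB.instance Definition _ := GRing.Linear.copy (@mul_lam R A)
  (mulvar (fun k => (k.1.+1, k.2))).
HB.instance Definition _ := GRing.Linear.copy (@mul_mu R A)
  (mulvar (fun k => (k.1, k.2.+1))).
HB.instance Definition _ := GRing.Linear.copy (@sub_lamDmu R A)
  (mul_lam \+ mul_mu).
HB.instance Definition _ := GRing.Linear.copy (@sub_NderBlam R A)
  ((\- (@der R _)) \- (@mul_lam1 R A)).
HB.instance Definition _ :=
  GRing.isLinear.Build _ _ _ _ (@const1 R A) (monalgU_is_linear A 0%N).
HB.instance Definition _ :=
  GRing.isLinear.Build _ _ _ _ (@const2 R A) (monalgU_is_linear A (0%N, 0%N)).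

Lemma mulvarU (K : choiceType) (h : K -> K) (x : A) k :
  mulvar h << x *g k >> = << x *g h k >>.
Proof. exact: (malg_sumU (fun l => @monalgUB K A (h l)) x k). Qed.

Lemma malg_ext (K : choiceType) (W : zmodType)
    (f g : {additive coefpoly A K -> W}) :
  (forall x k, f << x *g k >> = g << x *g k >>) -> f =1 g.
Proof.
by move=> fg p; rewrite (monalgE p) !raddf_sum; apply: eq_bigr.
Qed.

Lemma mul_lam_mu (p : A[λ,μ]) : mul_lam (mul_mu p) = mul_mu (mul_lam p).
Proof.
by move: p; apply: (malg_ext (f := mul_lam \o mul_mu) (g := mul_mu \o mul_lam))
  => x k; rewrite /= /mul_lam /mul_mu !mulvarU.
Qed.

End Operators.

(** * Substitution *)

Lemma eq_iterf (V : Type) (T T' : V -> V) n x :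
  T =1 T' -> iter n T x = iter n T' x.
Proof. by move=> eqT; elim: n => // n IHn; rewrite !iterS IHn eqT. Qed.

(** The common tool for composing substitutions, specializing variables and pulling signs out of
    nested products. *)
Lemma psubst_morph (R : realType) (A : lmodType {poly R[i]}) (M N : zmodType)
    (h : {additive M -> N}) (T : M -> M) (T' : N -> N) (f : A -> M)
    (p : A[λ]) :
  (forall m, h (T m) = T' (h m)) -> h (psubst T f p) = psubst T' (h \o f) p.
Proof.
by move=> hT; rewrite raddf_sum; apply: eq_bigr => n _; apply: iter_comm.
Qed.

Section Psubst.
Context (R : realType) (A : lmodType {poly R[i]}) (M : zmodType).
Implicit Types (p q : A[λ]) (f g : A -> M) (T D : {additive M -> M}).

Lemma eq_psubst (T T' : M -> M) f g p :
  T =1 T' -> (forall n, f p@_n = g p@_n) -> psubst T f p = psubst T' g p.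
Proof.
move=> eqT eqf; apply: eq_bigr => n _.
by rewrite eqf; apply: eq_iterf.
Qed.

Lemma psubstB (T : {additive M -> M}) (f g : A -> M) p :
  psubst T (fun x => f x - g x) p = psubst T f p - psubst T g p.
Proof.
by rewrite -sumrB; apply: eq_bigr => n _; rewrite iter_is_additive.
Qed.

Section Additive.
Context (T : {additive M -> M}) (f : A -> M).
Hypothesis addf : zmod_morphism f.

Let F_additive n : zmod_morphism (fun x => iter n T (f x)).
Proof. by move=> x y; rewrite addf iter_is_additive. Qed.

Lemma psubst_is_additive : zmod_morphism (psubst T f).
Proof. exact: malg_sum_is_additive F_additive. Qed.

Lemma psubstU x n : psubst T f << x *g n >> = iter n T (f x).
Proof. exact: (malg_sumU F_additive). Qed.

Lemma psubst_mul_lam1 p : psubst T f (mul_lam1 p) = T (psubst T f p).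
Proof.
move: p; apply: (malg_ext (f := additive_of psubst_is_additive \o @mul_lam1 R A)
  (g := T \o additive_of psubst_is_additive)) => x n /=.
by rewrite /mul_lam1 mulvarU !psubstU.
Qed.

Lemma der_malgU (K : choiceType) x (k : K) :
  der (<< x *g k >> : coefpoly A K) = << der x *g k >>.
Proof. by apply/malgP => l; rewrite coefpolyZ !mcoeffU scalerMnr. Qed.

Lemma psubst_der D p :
  (forall x, f (der x) = D (f x)) -> (forall m, D (T m) = T (D m)) ->
  psubst T f (der p) = D (psubst T f p).
Proof.
move=> fD DT; move: p.
apply: (malg_ext (f := additive_of psubst_is_additive \o @der R A[λ])
  (g := D \o additive_of psubst_is_additive)) => x n /=.
rewrite (der_malgU x n) !psubstU fD.
by rewrite -(iter_comm (h := D) (T := T) (T' := T)).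
Qed.

End Additive.

(* [D] is the action of ∂ transported by [f]: substituting -∂-λ for λ and then T
   for λ amounts to substituting -D-T. *)
Lemma psubst_sub_NderBlam T f D T' p :
  zmod_morphism f -> (forall x, f (der x) = D (f x)) ->
  (forall m, D (T m) = T (D m)) -> (forall m, T' m = - D m - T m) ->
  psubst T f (psubst (@sub_NderBlam R A) (@const1 R A) p) = psubst T' f p.
Proof.
move=> addf fD DT T'E.
pose h := additive_of (psubst_is_additive T addf).
rewrite -[LHS]/(h _) (psubst_morph (h := h) (T' := T')) => [|m]; last first.
  rewrite raddfB raddfN T'E /= psubst_mul_lam1 //.
  by rewrite (psubst_der addf _ fD DT).
by apply: eq_psubst => // n /=; rewrite psubstU.
Qed.

End Psubst.

(** * The Koszul signs *)

Section Sign.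
Context (R : realType) (M N : lmodType {poly R[i]}).

HB.instance Definition _ i j :=
  GRing.Linear.copy (@sgn R M i j) ( *:%R ((-1) ^+ (i * j)%N)).

Lemma sgn_sign i j (m : M) : sgn i j m = if odd (i * j) then - m else m.
Proof. by rewrite /sgn -signr_odd scaler_sign. Qed.

(** The scalar is 1 or -1, so additivity of [h] is enough; this matters for maps bundled only as
    additive, such as [spec2]. *)
Lemma raddf_sgn (h : {additive M -> N}) i j m : h (sgn i j m) = sgn i j (h m).
Proof.
by rewrite sgn_sign /sgn -signr_odd scaler_sign; case: odd; rewrite ?raddfN.
Qed.

Lemma sgnB i j (x y : M) : sgn i j (x - y) = sgn i j x - sgn i j y.
Proof. exact: scalerBr. Qed.

Lemma sgnK i j : involutive (@sgn R M i j).
Proof. by move=> m; rewrite !sgn_sign; case: odd; rewrite ?opprK. Qed.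

Lemma sgnC i j (m : M) : sgn i j m = sgn j i m.
Proof. by rewrite /sgn mulnC. Qed.

(** The sum [i + j] is taken modulo 2 whereas the exponent is a natural number, so only the parities
    of the two exponents agree. *)
Lemma sgnDl i j k (m : M) : sgn (i + j) k m = sgn i k (sgn j k m).
Proof.
rewrite !sgn_sign !oddM.
have -> : odd (i + j)%R = odd i (+) odd j.
  by case: i j => [[|[|//]] ?] [[|[|//]] ?].
by case: (odd i) (odd j) (odd k) => [] [] []; rewrite /= ?opprK.
Qed.

Lemma sgnDr i j k (m : M) : sgn k (i + j) m = sgn k i (sgn k j m).
Proof. by rewrite sgnC sgnDl !(sgnC k). Qed.

Lemma sgnCA i j k l (m : M) : sgn i j (sgn k l m) = sgn k l (sgn i j m).
Proof. by rewrite !sgn_sign; case: odd; case: odd. Qed.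

End Sign.

(** * Nested products *)

Section Conformal.
Context (R : realType) (A : lmodType {poly R[i]}) (G : z2grading A).
Implicit Types (f g circ star : A -> A -> A[λ]) (a b c x : A).
Local Notation N := (A[λ,μ]).
Implicit Types (P Q S T U : {linear N -> N}).

Lemma conf_additivel f b : conformal_superalgebra G f ->
  zmod_morphism (f^~ b).
Proof.
move=> cf x y; have := conf_linearl cf (-1) y x b.
by rewrite polyCN !scaleN1r ![- _ + _]addrC.
Qed.

Lemma conf_additiver f a : conformal_superalgebra G f ->
  zmod_morphism (f a).
Proof.
move=> cf x y; have := conf_linearr cf (-1) a y x.
by rewrite polyCN !scaleN1r ![- _ + _]addrC.
Qed.

Lemma const2_der x : const2 (der x) = der (const2 x).
Proof. by rewrite [RHS]der_malgU. Qed.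

(** ∂ is the scalar ['X]. This is why the operators put in place of the variables are required to be
    linear over C[∂]. *)
Lemma linear_der P (m : N) : P (der m) = der (P m).
Proof. exact: linearZ. Qed.

Section OuterFactor.
Context (f : A -> A -> A[λ]) (cf : conformal_superalgebra G f).

Lemma psubst_const2_additive U : zmod_morphism (psubst U (@const2 R A)).
Proof. by apply: psubst_is_additive; apply: raddfB. Qed.

Lemma outerl_additive U c :
  zmod_morphism (fun x => psubst U (@const2 R A) (f x c)).
Proof.
by move=> x y; rewrite (conf_additivel _ cf) psubst_const2_additive.
Qed.

Lemma outerr_additive T a :
  zmod_morphism (fun x => psubst T (@const2 R A) (f a x)).
Proof.
by move=> x y; rewrite (conf_additiver _ cf) psubst_const2_additive.
Qed.

(** Sesquilinearity after substitution: on the left of an outer product at [U], ∂ turns into [-U],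
    and on the right of one at [T] into ∂ + [T]. These are the operators [D] needed by
    [psubst_sub_NderBlam]. *)
Lemma outerl_der U c x :
  psubst U (@const2 R A) (f (der x) c) = - U (psubst U (@const2 R A) (f x c)).
Proof.
rewrite (conf_sesquil cf) -sub0r psubst_const2_additive.
rewrite -{1}(subrr 0) psubst_const2_additive subrr sub0r psubst_mul_lam1 //.
exact: raddfB.
Qed.

Lemma outerr_der T a x :
  psubst T (@const2 R A) (f a (der x)) =
  der (psubst T (@const2 R A) (f a x)) + T (psubst T (@const2 R A) (f a x)).
Proof.
have add := raddfB (@const2 R A : {additive A -> N}).
rewrite (conf_sesquir cf) -[mul_lam1 _]opprK psubst_const2_additive.
rewrite -[- mul_lam1 _]sub0r psubst_const2_additive.
rewrite -{1}(subrr 0) psubst_const2_additive subrr sub0r opprK.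
rewrite psubst_mul_lam1 // (psubst_der (D := @der R N) add) //.
  exact: const2_der.
by move=> m; apply: esym (linear_der T m).
Qed.

Lemma nestr_additive g (cg : conformal_superalgebra G g) T U a b :
  zmod_morphism (nestr f T a g U b).
Proof.
move=> x y; rewrite /nestr (conf_additiver _ cg) psubst_is_additive //.
exact: outerr_additive.
Qed.

Lemma nestl_additive g T U a b : zmod_morphism (nestl g T a b f U).
Proof.
move=> x y; rewrite /nestl -psubstB; apply: eq_psubst => // n.
by rewrite (conf_additiver _ cf) psubst_const2_additive.
Qed.

End OuterFactor.

Lemma eq_nestl f g a b c (T T' U U' : N -> N) :
  T =1 T' -> U =1 U' -> nestl f T a b g U c = nestl f T' a b g U' c.
Proof. by move=> eT eU; apply: eq_psubst => // n; apply: eq_psubst. Qed.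

Lemma psubst_opprod P (F : A -> N) (D Q : {additive N -> N}) f a b :
  zmod_morphism F -> (forall x, F (der x) = D (F x)) ->
  (forall m, D (P m) = P (D m)) -> (forall m, Q m = - D m - P m) ->
  psubst P F (opprod f a b) = psubst Q F (f a b).
Proof. exact: psubst_sub_NderBlam. Qed.

(** The result of the inner product is a left factor, where ∂ acts as [-S]. Hence -∂ - [P] becomes
    [S - P], which is [Q] when [S] is [P + Q]. *)
Lemma nestl_opprod_inner f g P T S a b c :
  conformal_superalgebra G g -> (forall m, S (P m) = P (S m)) ->
  (forall m, T m = S m - P m) ->
  nestl (opprod f) P a b g S c = nestl f T a b g S c.
Proof.
move=> cg SP TE; apply: (psubst_opprod (D := \- S)) => [|x|m|m] /=.
- exact: outerl_additive.
- exact: outerl_der cg _ _ _.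
- by rewrite SP; apply: esym; apply: raddfN.
- by rewrite TE; congr (_ - _); apply: esym; apply: opprK.
Qed.

(** Here the inner result is a right factor, where ∂ acts as ∂ + [P]. Hence -∂ - [Q] becomes -∂ -
    [P] - [Q]. *)
Lemma nestr_opprod_inner f g P Q T a b c :
  conformal_superalgebra G f -> (forall m, P (Q m) = Q (P m)) ->
  (forall m, T m = - (der m + P m) - Q m) ->
  nestr f P a (opprod g) Q b c = nestr f P a g T b c.
Proof.
move=> cf PQ TE; apply: (psubst_opprod (D := @der R N \+ P)) => [|x|m|m] /=.
- exact: outerr_additive.
- exact: outerr_der cf _ _ _.
- by rewrite PQ -linear_der; apply: esym; apply: raddfD.
- exact: TE.
Qed.

(** For the outermost product ∂ is not transported: it is the ∂ of A[λ,μ]. *)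
Lemma psubst_const2_opprod S T f a b :
  (forall m, T m = - der m - S m) ->
  psubst S (@const2 R A) (opprod f a b) = psubst T (@const2 R A) (f a b).
Proof.
move=> TE; apply: (psubst_opprod (D := @der R N)) => //.
- exact: raddfB.
- exact: const2_der.
- by move=> m; apply: esym (linear_der S m).
Qed.

End Conformal.

(** * Specialization of λ and μ to two commuting operators *)

Section Specialization.
Context (R : realType) (A : lmodType {poly R[i]}).
Local Notation N := (A[λ,μ]).
Context (P Q : {linear N -> N}).
Hypothesis PQ : forall m, P (Q m) = Q (P m).

Let F (k : nat * nat) (x : A) : N := iter k.1 P (iter k.2 Q (const2 x)).

Let F_additive k : zmod_morphism (F k).
Proof. by move=> x y; rewrite /F raddfB !iter_is_additive. Qed.

(** Evaluation at λ = [P], μ = [Q]. Applied to both sides of an identity in λ and μ, it gives the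
    same identity for [P] and [Q]. *)
Definition spec2 : {additive N -> N} :=
  additive_of (malg_sum_is_additive F_additive).

Lemma spec2U x k : spec2 << x *g k >> = F k x.
Proof. exact: (malg_sumU F_additive). Qed.

Lemma spec2_const2 x : spec2 (const2 x) = const2 x.
Proof. exact: spec2U. Qed.

Lemma spec2_lam m : spec2 (mul_lam m) = P (spec2 m).
Proof.
move: m; apply: (malg_ext (f := spec2 \o @mul_lam R A) (g := P \o spec2)).
move=> x k; rewrite -[LHS]/(spec2 (mul_lam _)) -[RHS]/(P (spec2 _)).
by rewrite /mul_lam mulvarU !spec2U.
Qed.

(** In [F] the powers of [Q] are applied before those of [P], so the additional [Q] has to pass
    every [P]; commutation enters here. *)
Lemma spec2_mu m : spec2 (mul_mu m) = Q (spec2 m).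
Proof.
move: m; apply: (malg_ext (f := spec2 \o @mul_mu R A) (g := Q \o spec2)).
move=> x k; rewrite -[LHS]/(spec2 (mul_mu _)) -[RHS]/(Q (spec2 _)).
rewrite /mul_mu mulvarU !spec2U /F.
by apply: esym; apply: iter_comm => v; rewrite PQ.
Qed.

Lemma spec2_lamDmu m : spec2 (sub_lamDmu m) = (P \+ Q) (spec2 m).
Proof. by rewrite raddfD spec2_lam spec2_mu. Qed.

Lemma spec2_nestl (T U T' U' : N -> N) f g a b c :
  (forall m, spec2 (T m) = T' (spec2 m)) ->
  (forall m, spec2 (U m) = U' (spec2 m)) ->
  spec2 (nestl f T a b g U c) = nestl f T' a b g U' c.
Proof.
move=> hT hU; rewrite (psubst_morph _ _ hT); apply: eq_psubst => // n.
rewrite [LHS](psubst_morph _ _ hU); apply: eq_psubst => // l.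
exact: spec2_const2.
Qed.

Lemma spec2_nestr (T U T' U' : N -> N) f g a b c :
  (forall m, spec2 (T m) = T' (spec2 m)) ->
  (forall m, spec2 (U m) = U' (spec2 m)) ->
  spec2 (nestr f T a g U b c) = nestr f T' a g U' b c.
Proof.
move=> hT hU; rewrite (psubst_morph _ _ hU); apply: eq_psubst => // n.
rewrite [LHS](psubst_morph _ _ hT); apply: eq_psubst => // l.
exact: spec2_const2.
Qed.

(** A multirule with one entry for each shape of nested product occurring in left-symmetry, (A) and
    (C). *)
Definition spec2E f g a b c :=
  (spec2_nestl f g a b c spec2_lam spec2_lamDmu,
   spec2_nestl f g a b c spec2_mu spec2_lamDmu,
   spec2_nestr f g a b c spec2_lam spec2_mu,
   spec2_nestr f g a b c spec2_mu spec2_lam).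

End Specialization.

Section Transfer.
Context (R : realType) (A : lmodType {poly R[i]}) (G : z2grading A).
Context (circ star : A -> A -> A[λ]).
Local Notation N := (A[λ,μ]).
Context (P Q : {linear N -> N}).
Hypothesis PQ : forall m, P (Q m) = Q (P m).
Implicit Types (i j k : 'Z_2) (a b c : A).

Lemma left_symmetric_spec i j a b c :
  left_symmetric_conformal_superalgebra G star ->
  a \in homog G i -> b \in homog G j ->
  nestl star P a b star (P \+ Q) c - nestr star P a star Q b c =
  sgn i j (nestl star Q b a star (P \+ Q) c - nestr star Q b star P a c).
Proof.
move=> [_ ls] ha hb; have := congr1 (spec2 P Q) (ls _ _ _ _ c ha hb).
by rewrite raddf_sgn !raddfB !(spec2E PQ).
Qed.

Lemma compatA_spec a b c : compatA circ star ->
  nestl circ P a b star (P \+ Q) c = nestr circ P a star Q b c.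
Proof.
by move=> cA; have := congr1 (spec2 P Q) (cA a b c); rewrite !(spec2E PQ).
Qed.

Lemma compatC_spec i j a b c : compatC G circ star ->
  a \in homog G i -> b \in homog G j ->
  nestr star P a circ Q b c =
  nestl star P a b circ (P \+ Q) c + sgn i j (nestr circ Q b star P a c).
Proof.
move=> cC ha hb; have := congr1 (spec2 P Q) (cC _ _ _ _ c ha hb).
by rewrite raddfD raddf_sgn !(spec2E PQ).
Qed.

End Transfer.

Lemma submodN (S : nzRingType) (V : lmodType S) (H : submodClosed V) (x : V) :
  x \in H -> - x \in H.
Proof. by move=> Hx; rewrite -scaleN1r rpredZ. Qed.

Lemma submodB (S : nzRingType) (V : lmodType S) (H : submodClosed V) (x y : V) :
  x \in H -> y \in H -> x - y \in H.
Proof. by move=> Hx Hy; rewrite rpredD ?submodN. Qed.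

(** * The commutator bracket *)

Section Components.
Context (R : realType) (A : lmodType {poly R[i]}) (G : z2grading A).

(** The difference of two decompositions is both even and odd, hence zero. *)
Lemma component_uniq (u0 u1 : A) : u0 \in homog G 0 -> u1 \in homog G 1 ->
  component G 0 (u0 + u1) = u0 /\ component G 1 (u0 + u1) = u1.
Proof.
move=> h0 h1; have e := component_sum G (u0 + u1).
have e01 : component G 0 (u0 + u1) - u0 = u1 - component G 1 (u0 + u1).
  apply/eqP; rewrite subr_eq addrAC eq_sym subr_eq [X in X == _]addrC.
  exact/eqP.
have z : component G 0 (u0 + u1) - u0 = 0.
  apply: (homog_disjoint (z := G)); first by rewrite submodB ?component_homog.
  by rewrite e01 submodB ?component_homog.
split; first exact: subr0_eq z.
by apply/esym/subr0_eq; rewrite -e01.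
Qed.

(** The bracket is defined through components, so its sesquilinearity requires the projections to
    commute with ∂. *)
Lemma component_is_linear i : linear (component G i).
Proof.
move=> s x y.
have [] := @component_uniq (s *: component G 0 x + component G 0 y)
                           (s *: component G 1 x + component G 1 y).
- by rewrite rpredD ?rpredZ ?component_homog.
- by rewrite rpredD ?rpredZ ?component_homog.
rewrite addrACA -scalerDr -!component_sum => c0 c1.
have [-> //|-> //] : i = 0 \/ i = 1.
by case: i => -[|[|//]] ?; [left | right]; apply: val_inj.
Qed.

HB.instance Definition _ i := GRing.isLinear.Build _ _ _ _ (component G i)
  (component_is_linear i).

End Components.

(** * The substitution of -∂-λ as an operator on A[λ] *)

Section Opposite.
Context (R : realType) (A : lmodType {poly R[i]}).
Implicit Types (p : A[λ]).

Definition opp_lam : A[λ] -> A[λ] := psubst (@sub_NderBlam R A) (@const1 R A).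

Lemma opp_lam_is_linear : linear opp_lam.
Proof.
apply: (malg_sum_is_linear (F := fun n x => iter n _ (const1 x))) => n s x y.
by rewrite linearP iter_is_linear.
Qed.

HB.instance Definition _ := GRing.isLinear.Build _ _ _ _ opp_lam
  opp_lam_is_linear.

Lemma opprodE f a b : opprod f a b = opp_lam (f a b).
Proof. by []. Qed.

(** Substituting twice puts -∂ - (-∂-λ) = λ for λ, and substituting λ for itself rebuilds [p] from
    its monomials. *)
Lemma opp_lamK : involutive opp_lam.
Proof.
move=> p; rewrite /opp_lam.
rewrite (psubst_sub_NderBlam (D := @der R A[λ]) (T' := @mul_lam1 R A))
  => [||x|m|m].
- rewrite [RHS]monalgE; apply: eq_bigr => n _.
  elim: n (p@_n) => // n IHn x.
  by rewrite iterS IHn; apply: mulvarU.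
- exact: raddfB.
- by rewrite [RHS]der_malgU.
- exact: esym (linearZ _ _).
- by rewrite opprB addrCA subrr addr0.
Qed.

Lemma opp_lam_der p : opp_lam (der p) = der (opp_lam p).
Proof. exact: linearZ. Qed.

Lemma opp_lam_mul_lam1 p :
  opp_lam (mul_lam1 p) = - der (opp_lam p) - mul_lam1 (opp_lam p).
Proof. by rewrite /opp_lam psubst_mul_lam1 //; apply: raddfB. Qed.

(** Multiplication by λ only moves coefficients, and [H] is stable under ∂ since it is a
    C[∂]-submodule. *)
Lemma opp_lam_coef (H : submodClosed A) p :
  (forall n, p@_n \in H) -> forall n, (opp_lam p)@_n \in H.
Proof.
move=> Hp n.
have Hiter x l : x \in H ->
    forall n, (iter l (@sub_NderBlam R A) (const1 x))@_n \in H.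
  move=> Hx; elim: l => [|l IHl] {}n; first by rewrite /const1 mcoeffU rpredMn.
  rewrite iterS mcoeffB mcoeffN coefpolyZ.
  apply: submodB; first by rewrite submodN ?rpredZ.
  rewrite /mul_lam1 /mulvar raddf_sum rpred_sum // => h _.
  by rewrite /= mcoeffU rpredMn.
by rewrite raddf_sum rpred_sum // => l _; apply: Hiter.
Qed.

End Opposite.

(** * The bracket as a conformal product, and its nested products *)

Section Commutator.
Context (R : realType) (A : lmodType {poly R[i]}) (G : z2grading A).
Context (star : A -> A -> A[λ]) (cstar : conformal_superalgebra G star).
Local Notation N := (A[λ,μ]).
Local Notation br := (commutator G star).
Implicit Types (i j k : 'Z_2) (a b c : A) (P Q S T : {linear N -> N}).


Lemma commutator_conformal : conformal_superalgebra G br.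
Proof.
split.
- move=> x a a' b; rewrite /commutator scaler_sumr -big_split /=.
  apply: eq_bigr => i _; rewrite scaler_sumr -big_split /=.
  apply: eq_bigr => j _; rewrite linearP /= (conf_linearl cstar) !opprodE.
  rewrite (conf_linearr cstar) linearP linearP opprD addrACA.
  by rewrite scalerBr.
- move=> x a b b'; rewrite /commutator scaler_sumr -big_split /=.
  apply: eq_bigr => i _; rewrite scaler_sumr -big_split /=.
  apply: eq_bigr => j _; rewrite linearP /= (conf_linearr cstar) !opprodE.
  rewrite (conf_linearl cstar) linearP linearP opprD addrACA.
  by rewrite scalerBr.
- move=> i j a b ha hb n; rewrite (commutatorE cstar ha hb) mcoeffB.
  apply: submodB; first exact: conf_graded cstar _ _ _ _ ha hb n.
  rewrite coefpolyZ rpredZ //; apply: opp_lam_coef => {}n.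
  by rewrite addrC; exact: conf_graded cstar _ _ _ _ hb ha n.
- move=> a b; rewrite /commutator [mul_lam1 _]raddf_sum -sumrN.
  apply: eq_bigr => i _; rewrite /= [mul_lam1 _]raddf_sum -sumrN.
  apply: eq_bigr => j _.
  rewrite [component G i _]linearZ -/(der _) (conf_sesquil cstar) !opprodE.
  (* In the opposite term ∂ + λ becomes ∂ + (-∂-λ) = -λ, the factor required on the left
     argument. *)
  rewrite (conf_sesquir cstar) raddfD /= opp_lam_der opp_lam_mul_lam1.
  rewrite addrA subrr sub0r [sgn i j (- _)]raddfN opprK.
  by rewrite [mul_lam1 (_ - _)]raddfB /= raddf_sgn opprB addrC.
- move=> a b; rewrite /commutator [der (\sum_(_ <- _) _)]raddf_sum.
  rewrite [mul_lam1 _]raddf_sum -big_split; apply: eq_bigr => i _ /=.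
  rewrite [der (\sum_(_ <- _) _)]raddf_sum [mul_lam1 _]raddf_sum -big_split.
  apply: eq_bigr => j _ /=.
  rewrite [component G j _]linearZ -/(der _) (conf_sesquir cstar) !opprodE.
  (* Conversely -λ becomes ∂ + λ in the opposite term. *)
  rewrite (conf_sesquil cstar) [opp_lam (- _)]raddfN /= opp_lam_mul_lam1.
  rewrite opprB opprK [der (_ - _)]raddfB [mul_lam1 (_ - _)]raddfB /=.
  rewrite [sgn i j (_ + _)]raddfD /= [der (sgn _ _ _)]raddf_sgn.
  rewrite [mul_lam1 (sgn _ _ _)]raddf_sgn opprD [RHS]addrACA.
  by congr (_ + _); apply: addrC.
Qed.

(** The double opposite disappears by [opp_lamK] and the double sign by [sgnK]. *)
Lemma commutator_skew i j a b : a \in homog G i -> b \in homog G j ->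
  br a b = - sgn i j (opprod br b a).
Proof.
move=> ha hb; rewrite opprodE (commutatorE cstar ha hb).
rewrite (commutatorE cstar hb ha).
rewrite !opprodE [opp_lam (_ - _)]raddfB /= [opp_lam (sgn _ _ _)]raddf_sgn.
rewrite /= opp_lamK [sgn i j (_ - _)]raddfB.
by rewrite /= (sgnC j) sgnK opprB.
Qed.

Lemma psubst_commutator i j a b (F : A -> N) P : zmod_morphism F ->
  a \in homog G i -> b \in homog G j ->
  psubst P F (br a b) =
  psubst P F (star a b) - sgn i j (psubst P F (opprod star b a)).
Proof.
move=> addF ha hb; rewrite (commutatorE cstar ha hb) psubst_is_additive //.
by rewrite -(raddf_sgn (additive_of (psubst_is_additive P addF))).
Qed.

Lemma nestl_commutator_inner i j g P T S a b c : conformal_superalgebra G g ->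
  (forall m, S (P m) = P (S m)) -> (forall m, T m = S m - P m) ->
  a \in homog G i -> b \in homog G j ->
  nestl br P a b g S c =
  nestl star P a b g S c - sgn i j (nestl star T b a g S c).
Proof.
move=> cg SP TE ha hb.
rewrite -(nestl_opprod_inner star b a c cg SP TE).
by apply: psubst_commutator => //; apply: outerl_additive cg _ _.
Qed.

Lemma nestr_commutator_inner j k f P Q T a b c : conformal_superalgebra G f ->
  (forall m, P (Q m) = Q (P m)) -> (forall m, T m = - (der m + P m) - Q m) ->
  b \in homog G j -> c \in homog G k ->
  nestr f P a br Q b c =
  nestr f P a star Q b c - sgn j k (nestr f P a star T c b).
Proof.
move=> cf PQ TE hb hc.
rewrite -(nestr_opprod_inner star a c b cf PQ TE).
by apply: psubst_commutator => //; apply: outerr_additive cf _ _.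
Qed.

Lemma psubst_sgn_fun P i j (F : A -> N) p :
  psubst P (fun x => sgn i j (F x)) p = sgn i j (psubst P F p).
Proof.
apply: esym; apply: (psubst_morph (h := @sgn R N i j)) => m.
by rewrite raddf_sgn.
Qed.

(** By the grading every coefficient of the inner product has parity [i + j], so the bracket with
    [c] expands coefficient by coefficient with one and the same sign. *)
Lemma nestl_commutator_outer i j k f P T S a b c : conformal_superalgebra G f ->
  (forall m, T m = - der m - S m) ->
  a \in homog G i -> b \in homog G j -> c \in homog G k ->
  nestl f P a b br S c =
  nestl f P a b star S c - sgn (i + j) k (nestr star T c f P a b).
Proof.
move=> cf TE ha hb hc; rewrite -psubst_sgn_fun -psubstB.
apply: eq_psubst => // n; have hx := conf_graded cf ha hb n.
rewrite (psubst_commutator _ _ hx hc); last exact: raddfB.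
by rewrite (psubst_const2_opprod _ _ _ TE).
Qed.

Lemma nestr_commutator_outer i j k f P Q T a b c : conformal_superalgebra G f ->
  (forall m, T m = - der m - P m) ->
  a \in homog G i -> b \in homog G j -> c \in homog G k ->
  nestr br P a f Q b c =
  nestr star P a f Q b c - sgn i (j + k) (nestl f Q b c star T a).
Proof.
move=> cf TE ha hb hc; rewrite -psubst_sgn_fun -psubstB.
apply: eq_psubst => // n; have hx := conf_graded cf hb hc n.
rewrite (psubst_commutator _ _ ha hx); last exact: raddfB.
by rewrite (psubst_const2_opprod _ _ _ TE).
Qed.

End Commutator.

(** * Exchanging factors of a commutative product inside nested products *)

Section CommutativeProduct.
Context (R : realType) (A : lmodType {poly R[i]}) (G : z2grading A).
Context (circ : A -> A -> A[λ]) (comm : conf_commutative G circ).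
Local Notation N := (A[λ,μ]).
Implicit Types (i j k : 'Z_2) (a b c : A) (P Q S T : {linear N -> N}).

Lemma nestl_comm_inner i j g P T S a b c : conformal_superalgebra G g ->
  (forall m, S (P m) = P (S m)) -> (forall m, T m = S m - P m) ->
  a \in homog G i -> b \in homog G j ->
  nestl circ P a b g S c = sgn i j (nestl circ T b a g S c).
Proof.
move=> cg SP TE ha hb; rewrite -(nestl_opprod_inner circ b a c cg SP TE).
have addF := psubst_is_additive P (outerl_additive cg S c).
by rewrite {1}/nestl (comm ha hb); apply: (raddf_sgn (additive_of addF)).
Qed.

Lemma nestl_comm_outer i j k f P T S a b c : conformal_superalgebra G f ->
  (forall m, T m = - der m - S m) ->
  a \in homog G i -> b \in homog G j -> c \in homog G k ->
  nestl f P a b circ S c = sgn (i + j) k (nestr circ T c f P a b).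
Proof.
move=> cf TE ha hb hc; rewrite -psubst_sgn_fun; apply: eq_psubst => // n.
rewrite (comm (conf_graded cf ha hb n) hc) -(psubst_const2_opprod _ _ _ TE).
exact: (raddf_sgn (additive_of (psubst_const2_additive S))).
Qed.

End CommutativeProduct.

(** * Cancellations in the Jacobi identity and the Leibniz rule *)

Lemma jacobi_sum (M : zmodType)
    (l1 r1 l1' r1' l2 r2 l2' r2' l3 r3 l3' r3' : M) :
  l1 - r1 = l1' - r1' -> l2 - r2 = l2' - r2' -> l3 - r3 = l3' - r3' ->
  r1 - r2 - (l3 - l3') =
  l1 - l1' - (r2' - r3') + (r1' - r3 - (l2 - l2')).
Proof.
(* Left-symmetry trades a difference of left-nested products [l] for one of right-nested products
   [r]; afterwards only right-nested terms are left, and they cancel. *)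
have swap l r l' r' : l - r = l' - r' -> l - l' = r - r' :> M.
  move=> /(canRL (subrK r)) ->.
  by rewrite addrAC [l' - r' - l']addrAC subrr sub0r addrC.
move=> /swap -> /swap -> /swap ->; rewrite !opprB [RHS]addrACA !addrA !subrK.
by rewrite -!addrA; congr (_ + _); rewrite addrC addrAC addrC.
Qed.

(** Reduces to [jacobi_sum] after multiplying the second hypothesis by the sign of ([j], [k]) and
    the third by those of ([i], [j]) and ([i], [k]). *)
Lemma jacobi_signs (R : realType) (M : lmodType {poly R[i]}) (i j k : 'Z_2)
    (l1 r1 l1' r1' l2 r2 l2' r2' l3 r3 l3' r3' : M) :
  l1 - r1 = sgn i j (l1' - r1') ->
  l2 - r2 = sgn i k (l2' - r2') ->
  l3 - r3 = sgn j k (l3' - r3') ->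
  r1 - sgn j k r2 - sgn i (j + k) (l3 - sgn j k l3') =
  l1 - sgn i j l1' - sgn (i + j) k (r2' - sgn i j r3') +
  sgn i j (r1' - sgn i k r3 - sgn j (i + k) (l2 - sgn i k l2')).
Proof.
move=> h1 h2 h3; rewrite !(sgnDl, sgnDr, sgnB) !(sgnC j i) !sgnK.
rewrite [sgn i k (sgn j k r2')]sgnCA.
rewrite [sgn j k (sgn i j _)]sgnCA [sgn i k (sgn i j _)]sgnCA.
apply: jacobi_sum; first by rewrite h1 sgnB.
  by rewrite -sgnB h2 !sgnB.
by rewrite -!sgnB h3 !sgnB.
Qed.

(** On the right, [x] and [z] each occur twice, which accounts for the factor 2; the hypotheses give
    the terms in [u] and [v] opposite values. *)
Lemma leibniz_signs (R : realType) (M : lmodType {poly R[i]}) (i j k : 'Z_2)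
    (x z u u' v v' : M) :
  u = sgn (k + i) j u' -> v = sgn (j + i) k v' -> u' = sgn j k v' ->
  (x - sgn j k z) *+ 2 =
  x - sgn (i + j) k (u + sgn k i z) +
  sgn i j (v + sgn j i x - sgn j (i + k) z).
Proof.
have sgnD l l' (y y' : M) : sgn l l' (y + y') = sgn l l' y + sgn l l' y'.
  exact: scalerDr.
move=> -> -> ->; rewrite !(sgnDl, sgnDr, sgnB, sgnD).
rewrite !(sgnC k j, sgnC k i, sgnC j i, sgnK).
rewrite [sgn j k (sgn i k z)]sgnCA !sgnK.
rewrite [sgn j k (sgn i k v')]sgnCA [sgn i j (sgn i k _)]sgnCA.
move: (sgn i k (sgn i j _)) (sgn j k z) => w y.
rewrite [w + y]addrC opprD [x + (_ - _)]addrA -[w + x - y]addrA.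
by rewrite [RHS]addrA subrK.
Qed.

(** * The Jacobi identity and the transposed Leibniz rule *)

Section OperatorTriple.
Context (R : realType) (A : lmodType {poly R[i]}).
Local Notation N := (A[λ,μ]).

(** A form of (λ, μ, ν) in which any of the three can play ν. One commutation is enough, as [S] is
    determined by [P], [Q] and ∂; [op_tripleC] and [op_tripleA] generate all permutations. *)
Definition op_triple (P Q S : {linear N -> N}) : Prop :=
  (forall m, P (Q m) = Q (P m)) /\ (forall m, P m + Q m + S m = - der m).

Context (P Q S : {linear N -> N}).

Lemma op_tripleC : op_triple P Q S -> op_triple Q P S.
Proof.
by move=> [PQ E]; split=> [m|m]; rewrite ?PQ // [Q m + _]addrC E.
Qed.

Lemma op_triple_opprod : op_triple P Q S ->
  forall m, S m = - (der m + P m) - Q m.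
Proof. by move=> [_ E] m; rewrite opprD -E -addrA -opprD addrC addKr. Qed.

Lemma op_triple_last : op_triple P Q S -> forall m, S m = - der m - (P \+ Q) m.
Proof. by move=> E m; rewrite (op_triple_opprod E) /= !opprD addrA. Qed.

Lemma op_tripleA : op_triple P Q S -> op_triple Q S P.
Proof.
move=> E; case: (E) => PQ E'; split=> m; last first.
  by rewrite -E' -[RHS]addrA [RHS]addrC.
rewrite !(op_triple_opprod E) raddfB raddfN raddfD /=.
by rewrite linear_der PQ.
Qed.

Lemma op_triple_sum : op_triple P Q S ->
  forall m, (Q \+ S) m = - der m - P m.
Proof.
by move=> [_ E] m; rewrite /= -E -[P m + _ + _]addrA [RHS]addrC addKr.
Qed.

End OperatorTriple.

Section Bracket.
Context (R : realType) (A : lmodType {poly R[i]}) (G : z2grading A).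
Context (circ star : A -> A -> A[λ]).
Context (cstar : conformal_superalgebra G star).
Local Notation N := (A[λ,μ]).
Local Notation br := (commutator G star).
Implicit Types (i j k : 'Z_2) (a b c : A) (P Q S : {linear N -> N}).

Lemma nestr_commutator_right j k f P Q S a b c : conformal_superalgebra G f ->
  op_triple P Q S -> b \in homog G j -> c \in homog G k ->
  nestr f P a br Q b c =
  nestr f P a star Q b c - sgn j k (nestr f P a star S c b).
Proof.
move=> cf E hb hc; case: (E) => PQ _.
exact: nestr_commutator_inner cf PQ (op_triple_opprod E) hb hc.
Qed.

Lemma nestr_commutator_left i j k f P Q S a b c : conformal_superalgebra G f ->
  op_triple P Q S -> a \in homog G i -> b \in homog G j -> c \in homog G k ->
  nestr br P a f Q b c =
  nestr star P a f Q b c - sgn i (j + k) (nestl f Q b c star (Q \+ S) a).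
Proof.
by move=> cf E; apply: nestr_commutator_outer => //; apply: op_triple_sum.
Qed.

Lemma nestl_commutator_left i j g P Q a b c : conformal_superalgebra G g ->
  (forall m, P (Q m) = Q (P m)) -> a \in homog G i -> b \in homog G j ->
  nestl br P a b g (P \+ Q) c =
  nestl star P a b g (P \+ Q) c - sgn i j (nestl star Q b a g (P \+ Q) c).
Proof.
pose nci := @nestl_commutator_inner _ _ _ _ cstar.
move=> cg PQ; apply: (nci _ _ _ P Q (P \+ Q)) => // m /=.
  by rewrite raddfD /= PQ.
by rewrite addrC addKr.
Qed.

Lemma nestl_commutator_right i j k f P Q S a b c : conformal_superalgebra G f ->
  op_triple P Q S -> a \in homog G i -> b \in homog G j -> c \in homog G k ->
  nestl f P a b br (P \+ Q) c =
  nestl f P a b star (P \+ Q) c - sgn (i + j) k (nestr star S c f P a b).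
Proof.
pose nco := @nestl_commutator_outer _ _ _ _ cstar.
move=> cf E; apply: (nco _ _ _ _ P S (P \+ Q)) => //.
exact: op_triple_last.
Qed.

Lemma jacobi_homog i j k P Q S a b c :
  left_symmetric_conformal_superalgebra G star -> op_triple P Q S ->
  a \in homog G i -> b \in homog G j -> c \in homog G k ->
  nestr br P a br Q b c =
  nestl br P a b br (P \+ Q) c + sgn i j (nestr br Q b br P a c).
Proof.
move=> ls E ha hb hc; have cbr := commutator_conformal cstar.
have EQPS := op_tripleC E; have EQSP := op_tripleA E.
have ESPQ := op_tripleA EQSP; have EPSQ := op_tripleC ESPQ.
(* In each of the three terms the outer bracket is expanded first, then the inner one, leaving
   twelve nested products of [star]. *)
rewrite (nestr_commutator_left cbr E ha hb hc).
rewrite (nestr_commutator_right a cstar E hb hc).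
rewrite (nestl_commutator_left a cstar EQSP.1 hb hc).
rewrite (nestl_commutator_right cbr E ha hb hc).
rewrite (nestl_commutator_left c cstar E.1 ha hb).
rewrite (nestr_commutator_right c cstar ESPQ ha hb).
rewrite (nestr_commutator_left cbr EQPS hb ha hc).
rewrite (nestr_commutator_right b cstar EQPS ha hc).
rewrite (nestl_commutator_left b cstar EPSQ.1 ha hc).
have h1 := left_symmetric_spec E.1 c ls ha hb.
have h2 := left_symmetric_spec EPSQ.1 b ls ha hc.
have h3 := left_symmetric_spec EQSP.1 a ls hb hc.
exact: jacobi_signs h1 h2 h3.
Qed.

Lemma transposed_leibniz_homog i j k P Q S a b c :
  comm_assoc_conformal_superalgebra G circ -> compatA circ star ->
  compatC G circ star -> op_triple P Q S ->
  a \in homog G i -> b \in homog G j -> c \in homog G k ->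
  nestr circ P a br Q b c *+ 2 =
  nestl circ P a b br (P \+ Q) c + sgn i j (nestr br Q b circ P a c).
Proof.
move=> [ccirc comm _] cA cC E ha hb hc.
have EQPS := op_tripleC E; have EQSP := op_tripleA E.
have ESPQ := op_tripleA EQSP; have EPSQ := op_tripleC ESPQ.
have ESQP := op_tripleC EQSP.
rewrite (nestr_commutator_right a ccirc E hb hc).
rewrite (nestl_commutator_right ccirc E ha hb hc).
rewrite (nestr_commutator_left ccirc EQPS hb ha hc).
(* (A) and (C) each produce one copy of the two products with [a] outermost; (C) also leaves two
   products with [circ] outside. *)
rewrite (compatA_spec E.1 a b c cA) (compatA_spec EPSQ.1 a c b cA).
rewrite (compatC_spec ESPQ.1 b cC hc ha) (compatC_spec EQPS.1 c cC hb ha).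
have comm_outer := nestl_comm_outer comm.
(* Commutativity of the outer [circ] moves its right factor to the front, at the remaining operator
   of the triple. *)
have u := comm_outer _ _ _ _ S _ _ _ _ _ cstar (op_triple_last ESPQ) hc ha hb.
have v := comm_outer _ _ _ _ Q _ _ _ _ _ cstar (op_triple_last EQPS) hb ha hc.
apply: leibniz_signs u v _.
(* (A) read backwards brings [b] and [c] together under [circ], where commutativity compares the two
   products. *)
rewrite -(compatA_spec EQSP.1 b c a cA) -(compatA_spec ESQP.1 c b a cA).
rewrite (nestl_comm_inner comm (S := Q \+ S) (T := S) a cstar _ _ hb hc).
- by congr sgn; apply: eq_nestl => // m /=; apply: addrC.
- by move=> m; rewrite /= raddfD /= EQSP.1.
- by move=> m; rewrite /= addrC addKr.
Qed.

End Bracket.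

Section MainTheorem.
Context (R : realType) (L : lmodType {poly R[i]}) (G : z2grading L).
Context (circ star : L -> L -> L[λ]).
Local Notation N := (L[λ,μ]).
Local Notation br := (commutator G star).

Definition mul_nu : N -> N := (\- (@der R N)) \- (mul_lam \+ mul_mu).
HB.instance Definition _ := GRing.Linear.copy mul_nu
  ((\- (@der R N)) \- (mul_lam \+ mul_mu)).

Lemma op_triple_lam_mu : op_triple (@mul_lam R L) (@mul_mu R L) mul_nu.
Proof.
by split=> m; [apply: mul_lam_mu | rewrite /mul_nu /= addrC subrK].
Qed.

(** The identities are required for arbitrary [c], while expanding brackets needs [c] homogeneous;
    additivity in [c] bridges the gap. *)
Lemma eq_on_homog (f g : L -> N) : zmod_morphism f -> zmod_morphism g ->
  (forall k c, c \in homog G k -> f c = g c) -> f =1 g.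
Proof.
move=> addf addg fg c; rewrite (component_sum G c).
rewrite [LHS](raddfD (additive_of addf)) [RHS](raddfD (additive_of addg)).
by congr (_ + _); apply: (fg _ _ (component_homog G _ c)).
Qed.

Lemma addr_sgn_additive i j (f g : L -> N) :
  zmod_morphism f -> zmod_morphism g ->
  zmod_morphism (fun c => f c + sgn i j (g c)).
Proof. by move=> addf addg x y; rewrite addf addg sgnB opprD addrACA. Qed.

Lemma prelie_commutative_transposed_poisson :
  prelie_commutative_conformal_superalgebra G circ star ->
  compatA circ star -> transposed_poisson_conformal_superalgebra G circ br.
Proof.
move=> [ca ls cC] cA; have cstar := ls.1; have [ccirc _ _] := ca.
have cbr := commutator_conformal cstar.
split; first exact: ca.
- split; [exact: cbr | exact: commutator_skew |].
  move=> i j a b c ha hb; move: c; apply: eq_on_homog => [x y|x y|k c hc].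
  + exact: (nestr_additive cbr).
  + apply: (addr_sgn_additive i j) => {x y} x y.
      exact: (nestl_additive cbr).
    exact: (nestr_additive cbr).
  + exact: (jacobi_homog cstar ls op_triple_lam_mu ha hb hc).
- move=> i j a b c ha hb; move: c; apply: eq_on_homog => [x y|x y|k c hc].
  + by rewrite (nestr_additive ccirc cbr) mulrnBl.
  + apply: (addr_sgn_additive i j) => {x y} x y.
      exact: (nestl_additive cbr).
    exact: (nestr_additive cbr).
  + exact: (transposed_leibniz_homog cstar ca cA cC op_triple_lam_mu ha hb hc).
Qed.

End MainTheorem.

Theorem corollary4p12 (R : realType) (L : lmodType {poly R[i]})
    (G : z2grading L) (circ star : L -> L -> L[λ]) :
  (prelie_commutative_conformal_superalgebra G circ star ->
   (forall a b c : L,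
      nestl circ mul_lam a b star sub_lamDmu c =
      nestr circ mul_lam a star mul_mu b c) ->
   transposed_poisson_conformal_superalgebra G circ (commutator G star)) /\
  (diff_novikov_poisson_conformal_superalgebra G circ star ->
   transposed_poisson_conformal_superalgebra G circ (commutator G star)).
Proof.
split; first exact: prelie_commutative_transposed_poisson.
(* A Novikov product is left-symmetric by definition, so with (C) the triple is pre-Lie commutative,
   and (A) supplies the other hypothesis. *)
move=> [ca [ls _] cA _ cC].
exact: prelie_commutative_transposed_poisson.
Qed.
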